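(* Let $X$ be a real Banach space and let $f_0, f_k : X\to\mathbb{R}\cup\{+\infty\}$ ($k\ge 1$) be proper convex functions. Let $(\mathcal P)$ be the problem $\inf\{f_0(x) : x\in X,\ f_k(x)\le 0\ \forall k\ge 1\}$, with optimal value $v(\mathcal P)<+\infty$. Put $f:=\sup_{k\ge1}f_k$ and $f_\infty:=\limsup_{k\to\infty}f_k$ (pointwise), and let $(\mathcal P_\infty^{**})$ be the problem $$\inf\Big\{f_0^{**}(z) : z\in X^{**},\ f_k^{**}(z)\le 0\ \forall k\ge 1,\ f_\infty^{**}(z)\le 0,\ z\in\overline{\operatorname{dom}(f^{**})}^{w^{**}}\Big\}.$$ Suppose that $(\mathcal P)$ satisfies the Slater condition, i.e. there is $x_0\in\operatorname{dom}f_0$ with $\sup_{k\ge1}f_k(x_0)<0$. If $f$ is continuous at some point in $\operatorname{dom}f_0$, then $$v(\mathcal P_\infty^{**})=v(\mathcal P).$$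
   Context: $X^*$ and $X^{**}$ are the dual and bidual of $X$, with $X\subset X^{**}$ canonically. $\operatorname{dom}h:=\{h<+\infty\}$. For $h:X\to\overline{\mathbb R}$: $h^*(x^* ):=\sup_{x\in X}(\langle x^*,x\rangle-h(x))$ for $x^*\in X^*$, and $h^{**}(z):=\sup_{x^*\in X^*}(\langle z,x^*\rangle-h^*(x^* ))$ for $z\in X^{**}$. $\overline{A}^{w^{**}}$ is the closure of $A\subset X^{**}$ in the weak-* topology $w^{**}=\sigma(X^{**},X^* )$. $v(\cdot)$ denotes the optimal value of a minimization problem, equal to $+\infty$ if it is infeasible. $f_\infty(x):=\limsup_{k\to\infty}f_k(x)$ is regarded in the paper as a function $X\to\mathbb R\cup\{+\infty\}$; when the number of constraints is finite, one sets $f_\infty\equiv-\infty$ (so that $f_\infty^{**}\equiv-\infty$). *)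

(* Defs.v *)
Set Warnings "-all".
From HB Require Import structures.
From mathcomp Require Import all_boot all_order all_algebra.
From mathcomp Require Import all_classical all_reals all_analysis.

Set Implicit Arguments.
Unset Strict Implicit.
Unset Printing Implicit Defensive.

Import Order.TTheory GRing.Theory Num.Theory.
Import numFieldNormedType.Exports.

Local Open Scope classical_set_scope.
Local Open Scope ring_scope.

Section Dual.
Context {R : realType} (X : normedModType R).

Definition dual_pred : {pred X -> R^o} :=
  fun phi => `[< linear phi /\ continuous phi >].

Fact dual_submod_closed : submod_closed dual_pred.
Proof.
split.
  apply/asboolP; split; last by move=> x; exact: cvg_cst.
  by move=> a x y /=; rewrite scaler0 addr0.
move=> a u v /asboolP[lu cu] /asboolP[lv cv]; apply/asboolP; split.
  move=> b x y; rewrite !addrfctE !scalrfctE /= lu lv !scalerDr.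
  by rewrite !scalerA (mulrC a b) addrACA.
by move=> x; apply: cvgD; [apply: cvgZr; exact: cu|exact: cv].
Qed.

HB.instance Definition _ :=
  GRing.isSubmodClosed.Build R (X -> R^o) dual_pred dual_submod_closed.

Record dual := Dual { dual_fun :> X -> R^o ; _ : dual_fun \in dual_pred }.

HB.instance Definition _ := [isSub for dual_fun].
HB.instance Definition _ := [Choice of dual by <:].
HB.instance Definition _ := [SubChoice_isSubLmodule of dual by <:].

Definition dual_norm (phi : dual) : R :=
  sup [set `|phi x| | x in [set x : X | `|x| <= 1]].

Lemma dual_linear (phi : dual) : linear phi.
Proof. by case: phi => phi /= /asboolP[]. Qed.

Lemma dual_continuous (phi : dual) : continuous phi.
Proof. by case: phi => phi /= /asboolP[]. Qed.

HB.instance Definition _ (phi : dual) :=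
  GRing.isLinear.Build R X R^o *:%R (dual_fun phi) (dual_linear phi).

Let ball1_image_nonempty (phi : dual) :
  [set `|phi x| | x in [set x : X | `|x| <= 1]] !=set0.
Proof. by exists `|phi 0|, 0 => //=; rewrite normr0 ler01. Qed.

Let ball1_image_ubound (phi : dual) :
  has_ubound [set `|phi x| | x in [set x : X | `|x| <= 1]].
Proof.
have /linear_bounded_continuous/bounded_funP/(_ 1)[M HM] :
  continuous phi := @dual_continuous phi.
by exists M => _ [x /= x1 <-]; exact: HM.
Qed.

Lemma dual_norm_ge (phi : dual) (x : X) : `|x| <= 1 -> `|phi x| <= dual_norm phi.
Proof. by move=> x1; apply: ub_le_sup => //; exists x. Qed.

Lemma dual_norm_le (phi : dual) (M : R) :
  (forall x : X, `|x| <= 1 -> `|phi x| <= M) -> dual_norm phi <= M.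
Proof. by move=> HM; apply: ge_sup => // _ [x /= x1 <-]; exact: HM. Qed.

Fact dual_ler_normD (phi psi : dual) :
  dual_norm (phi + psi) <= dual_norm phi + dual_norm psi.
Proof.
apply: dual_norm_le => x x1.
by rewrite (le_trans (ler_normD _ _))// lerD// dual_norm_ge.
Qed.

Fact dual_normrZ (a : R) (phi : dual) :
  dual_norm (a *: phi) = `|a| * dual_norm phi.
Proof.
have le b psi : dual_norm (b *: psi) <= `|b| * dual_norm psi.
  apply: dual_norm_le => x x1.
  by rewrite [X in X <= _]normrM ler_wpM2l// dual_norm_ge.
apply/eqP; rewrite eq_le le/=; have [->|a0] := eqVneq a 0.
  rewrite normr0 mul0r.
  by rewrite (le_trans (normr_ge0 _) (@dual_norm_ge _ 0 _))// normr0 ler01.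
rewrite -ler_pdivlMl ?normr_gt0// -normfV.
by rewrite (le_trans _ (le _ _))// scalerA mulVf// scale1r.
Qed.

Fact dual_normr0_eq0 (phi : dual) : dual_norm phi = 0 -> phi = 0.
Proof.
move=> phi0; apply/val_inj/funext => x /=.
have [->|x0] := eqVneq x 0; first by rewrite linear0.
have : `|phi (`|x|^-1 *: x)| <= 0.
  rewrite -phi0; apply: dual_norm_ge.
  by rewrite normrZ normfV normr_id mulVf ?normr_eq0.
rewrite normr_le0 linearZ /= scaler_eq0 invr_eq0 normr_eq0 (negbTE x0) /=.
by move/eqP.
Qed.

HB.instance Definition _ := Lmodule_isNormed.Build R dual
  dual_ler_normD dual_normrZ dual_normr0_eq0.

End Dual.

(* The topology sigma(dual Y, Y), i.e. pointwise convergence on Y. With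
   Y = dual X it is the weak-star topology of the bidual of X. *)
Definition weak_star {R : realType} (Y : normedModType R) : topologicalType :=
  initial_topology (fun phi : dual Y => (phi : {ptws Y -> R^o})).

Definition weak_star_closure {R : realType} (Y : normedModType R)
    (A : set (dual Y)) : set (dual Y) :=
  closure (A : set (weak_star Y)).

Section ExtendedFunctions.
Context {R : realType}.
Local Open Scope ereal_scope.

Definition edom (T : Type) (h : T -> \bar R) : set T := [set x | h x < +oo].

Definition eproper (T : Type) (h : T -> \bar R) : Prop :=
  (forall x, -oo < h x) /\ edom h !=set0.

(* Only used together with [eproper]: for a function that takes both values
   -oo and +oo the right-hand side would be the library's -oo + +oo = -oo. *)
Definition econvex (V : lmodType R) (h : V -> \bar R) : Prop :=
  forall (x y : V) (t : R), (0 <= t <= 1)%R ->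
    h (t *: x + (1 - t) *: y)%R <= t%:E * h x + (1 - t)%:E * h y.

Definition conjugate (Y : normedModType R) (h : Y -> \bar R)
    (phi : dual Y) : \bar R :=
  ereal_sup [set (phi y : R)%:E - h y | y in [set: Y]].

Definition biconjugate (X : normedModType R) (h : X -> \bar R) :
    dual (dual X) -> \bar R :=
  conjugate (conjugate h).

End ExtendedFunctions.

Section Programs.
Context {R : realType}.
Local Open Scope ereal_scope.

(* [N = None] stands for the constraints f 1, f 2, ... and [N = Some m] for the
   constraints f 1, ..., f m. The objective is f 0. *)
Definition constraints (N : option nat) : set nat :=
  [set k | (0 < k)%N /\ (if N is Some m then (k <= m)%N else true)].

Definition fsup (N : option nat) (T : Type) (f : nat -> T -> \bar R)
    (x : T) : \bar R :=
  ereal_sup [set f k x | k in constraints N].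

(* With finitely many constraints the limsup is -oo by convention, which makes
   the constraint on its biconjugate void. *)
Definition flimsup (N : option nat) (T : Type) (f : nat -> T -> \bar R)
    (x : T) : \bar R :=
  if N is Some _ then -oo else limn_esup (fun k => f k x).

Definition optimal_value (T : Type) (h : T -> \bar R) (S : set T) : \bar R :=
  ereal_inf [set h x | x in S].

Definition primal_feasible (N : option nat) (T : Type)
    (f : nat -> T -> \bar R) : set T :=
  [set x | forall k, constraints N k -> f k x <= 0].

Definition primal_value (N : option nat) (T : Type)
    (f : nat -> T -> \bar R) : \bar R :=
  optimal_value (f 0%N) (primal_feasible N f).

Definition bidual_feasible (N : option nat) (X : normedModType R)
    (f : nat -> X -> \bar R) : set (dual (dual X)) :=
  [set z | [/\ forall k, constraints N k -> biconjugate (f k) z <= 0,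
               biconjugate (flimsup N f) z <= 0 &
               weak_star_closure (edom (biconjugate (fsup N f))) z]].

Definition bidual_value (N : option nat) (X : normedModType R)
    (f : nat -> X -> \bar R) : \bar R :=
  optimal_value (biconjugate (f 0%N)) (bidual_feasible N f).

Definition slater (N : option nat) (T : Type) (f : nat -> T -> \bar R) : Prop :=
  exists2 x, edom (f 0%N) x & fsup N f x < 0.

End Programs.

(* Main.v *)
Require Import Defs.
From HB Require Import structures.
From mathcomp Require Import all_boot all_order all_algebra.
From mathcomp Require Import all_classical all_reals all_analysis.
From mathcomp Require Import ring lra.
Import Order.TTheory GRing.Theory Num.Theory.
Import numFieldNormedType.Exports.
Local Open Scope classical_set_scope.
Local Open Scope ring_scope.

Set Implicit Arguments.
Unset Strict Implicit.
Unset Printing Implicit Defensive.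

(* The inequality [v(P_inf) <= v(P)] is the canonical embedding of [X].
   Conversely, write [v] for the value of (P), which may be assumed real. Then
   [max (f0 - v) f >= 0], and by Hahn-Banach the affine minorant [0] of this
   maximum splits into affine minorants of [lam (f0 - v)] and [(1 - lam) f], with
   [lam > 0] by the Slater condition. The second one is peeled repeatedly along
   [sup_(k >= n) f_k = max f_n (sup_(k > n) f_k)]: at each step an affine minorant
   of a multiple of [f_n] splits off. Since all the functions are nonpositive on a
   ball, the linear parts that remain form a Cauchy sequence; its limit minorizes a
   multiple [m] of the limsup on [dom f], where [m = 0] stands for the indicator of
   [dom f]. Every piece is nonpositive at a point [z] feasible for the bidual
   problem, hence so is the minorant of [(1 - lam) f]; as the two minorants add up
   to [0], that of [lam (f0 - v)] is nonnegative at [z], i.e. [f0** z >= v]. *)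

(** * The Hahn-Banach theorem through minimal sublinear functions *)

Section HahnBanach.
Context {R : realType} (V : lmodType R).
Implicit Types (p q : V -> R) (v w : V).

Definition sublinear q :=
  (forall v w, q (v + w) <= q v + q w) /\
  (forall t v, 0 < t -> q (t *: v) = t * q v).

Lemma sublinear0 q : sublinear q -> q 0 = 0.
Proof. by case=> _ /(_ 2 0 (ltr0Sn _ _)); rewrite scaler0; lra. Qed.

Lemma sublinear_opp q v : sublinear q -> - q (- v) <= q v.
Proof.
move=> qs; rewrite -subr_ge0 opprK -(sublinear0 qs) -(subrr v).
exact: qs.1.
Qed.

Lemma sublinear_le q : (forall v w, q (v + w) <= q v + q w) ->
  (forall t v, 0 < t -> q (t *: v) <= t * q v) -> sublinear q.
Proof.
move=> qD qZ; split=> // t v t0; apply/eqP; rewrite eq_le qZ//= -ler_pdivlMl//.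
have := qZ t^-1 (t *: v); rewrite invr_gt0 => /(_ t0).
by rewrite scalerA mulVf ?gt_eqF// scale1r.
Qed.

(** Zorn's lemma for the reversed pointwise order. The infimum [g] of a chain is finite, being
    bounded below by [- q (- v)], and subadditive, because the smaller of two members of the chain
    serves for both arguments. *)
Lemma minimal_sublinear q : sublinear q ->
  exists p, [/\ sublinear p, forall v, p v <= q v &
    forall p', sublinear p' -> (forall v, p' v <= p v) -> p' = p].
Proof.
move=> qs; pose T := {p | sublinear p /\ forall v, p v <= q v}.
pose le (p1 p2 : T) := `[< forall v, sval p2 v <= sval p1 v >].
have [|p1 p2 p3 /asboolP l1 /asboolP l2|[p1 ?] [p2 ?] /asboolP l1 /asboolP l2|A tA|] :=
    @Zorn T le.
- by move=> p; apply/asboolP.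
- by apply/asboolP => v; exact: le_trans (l2 v) (l1 v).
- by apply/eq_exist/funext => v; apply/eqP; rewrite eq_le l1 l2.
- have [[p0 Ap0]|A0] := pselect (A !=set0); last first.
    have qq : sublinear q /\ forall v, q v <= q v by [].
    by exists (exist _ q qq) => s As; case: A0; exists s.
  pose S v := [set sval p v | p in A].
  pose g v := inf (S v).
  have Sinf v : has_inf (S v).
    split; first by exists (sval p0 v), p0.
    exists (- q (- v)) => _ [[p [ps pq]] Ap <-] /=.
    by rewrite (le_trans _ (sublinear_opp v ps))// lerN2.
  have gle (p : T) v : A p -> g v <= sval p v.
    by move=> Ap; apply: ge_inf; [exact: (Sinf v).2|exists p].
  have gs : sublinear g.
    apply: sublinear_le => [v w|t v t0].
      apply/ler_addgt0Pr => e e0.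
      have e20 : 0 < e / 2 by lra.
      have [_ [p1 A1 <-] h1] := inf_adherent e20 (Sinf v).
      have [_ [p2 A2 <-] h2] := inf_adherent e20 (Sinf w).
      have [p [Ap pv pw]] : exists p : T, [/\ A p, sval p v <= sval p1 v
          & sval p w <= sval p2 w].
        have [/asboolP l|/asboolP l] := tA _ _ A1 A2.
          by exists p2; split.
        by exists p1; split.
      have := (svalP p).1.1 v w; have := gle p (v + w) Ap; rewrite /g in h1 h2 *.
      lra.
    rewrite -ler_pdivrMl//; apply: lb_le_inf; first exact: (Sinf _).1.
    move=> _ [p Ap <-]; rewrite ler_pdivrMl// -(svalP p).1.2//.
    exact: gle.
  have gq v : g v <= q v by exact: le_trans (gle p0 v Ap0) ((svalP p0).2 v).
  by exists (exist _ g (conj gs gq)) => p Ap; apply/asboolP => v /=; exact: gle.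
- move=> [p [ps pq]] pmin; exists p; split=> // p' p's p'p.
  have p'q v : p' v <= q v by exact: le_trans (p'p v) (pq v).
  have pp' : le (exist _ p (conj ps pq)) (exist _ p' (conj p's p'q)).
    by apply/asboolP => v; exact: p'p.
  by have /(congr1 sval) := pmin _ pp'.
Qed.

(* A minimal [p] is additive: [w |-> inf_(t >= 0) p (w + t v) - t p v] is
   sublinear and below [p], hence equal to it. *)
Lemma minimal_sublinear_linear p : sublinear p ->
  (forall p', sublinear p' -> (forall v, p' v <= p v) -> p' = p) ->
  linear (p : V -> R^o).
Proof.
move=> ps pmin.
have padd v w : p (w + v) = p w + p v.
  pose S w := [set p (w + t *: v) - t * p v | t in [set t : R | 0 <= t]].
  pose g w := inf (S w).
  have tp t : 0 <= t -> p (t *: v) = t * p v.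
    rewrite le_eqVlt => /predU1P[<-|]; last exact: ps.2.
    by rewrite scale0r mul0r sublinear0.
  have Sinf w' : has_inf (S w').
    split; first by exists (p (w' + 0 *: v) - 0 * p v), 0 => /=.
    exists (- p (- w')) => _ [t /= t0 <-].
    have := ps.1 (- w') (w' + t *: v); rewrite addKr tp//; lra.
  have gle w' t : 0 <= t -> g w' <= p (w' + t *: v) - t * p v.
    by move=> t0; apply: ge_inf; [exact: (Sinf w').2|exists t].
  have gs : sublinear g.
    apply: sublinear_le => [w1 w2|t w' t0].
      apply/ler_addgt0Pr => e e0.
      have e20 : 0 < e / 2 by lra.
      have [_ [t1 /= t10 <-] h1] := inf_adherent e20 (Sinf w1).
      have [_ [t2 /= t20 <-] h2] := inf_adherent e20 (Sinf w2).
      have := gle (w1 + w2) (t1 + t2) (addr_ge0 t10 t20).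
      have := ps.1 (w1 + t1 *: v) (w2 + t2 *: v).
      rewrite addrACA -scalerDl; rewrite /g in h1 h2 *; lra.
    rewrite -ler_pdivrMl//; apply: lb_le_inf; first exact: (Sinf _).1.
    move=> _ [r /= r0 <-]; rewrite ler_pdivrMl//.
    have := gle (t *: w') (t * r) (mulr_ge0 (ltW t0) r0).
    by rewrite -scalerA -scalerDr ps.2// mulrBr mulrA.
  have gp : g = p.
    apply: pmin => // w'; have := gle w' 0 (lexx _).
    by rewrite scale0r addr0 mul0r subr0.
  (* As [g = p], the term [t = 1] of the infimum gives superadditivity. *)
  apply/eqP; rewrite eq_le ps.1/=.
  have := gle w 1 ler01; rewrite gp scale1r mul1r; lra.
have pN v : p (- v) = - p v.
  have := padd v (- v); rewrite addNr sublinear0//; lra.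
move=> t v w; rewrite padd; congr (_ + _).
have [t0|t0|->] := ltgtP t 0; last by rewrite !scale0r sublinear0.
- by rewrite -[t in LHS]opprK scaleNr pN ps.2 ?oppr_gt0// mulNr opprK.
- exact: ps.2.
Qed.

Lemma hahn_banach q : sublinear q ->
  exists2 p, linear (p : V -> R^o) & forall v, p v <= q v.
Proof.
move=> /minimal_sublinear[p [ps pq pmin]]; exists p => //.
exact: minimal_sublinear_linear.
Qed.

(** The infimum of [r] over [K v r] is sublinear in [v]. It is finite because [K (- v) r0] and
    [K v r] add up to [K 0 (r0 + r)], so [r >= - r0]. *)
Lemma hahn_banach_cone (K : V -> R -> Prop) :
  (forall v w r s, K v r -> K w s -> K (v + w) (r + s)) ->
  (forall t v r, 0 < t -> K v r -> K (t *: v) (t * r)) ->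
  (forall v, exists r, K v r) -> (forall r, K 0 r -> 0 <= r) ->
  exists2 p, linear (p : V -> R^o) & forall v r, K v r -> p v <= r.
Proof.
move=> KD KZ Kne K0.
have Kinf v : has_inf [set r | K v r].
  split; first exact: Kne.
  have [r0 Kr0] := Kne (- v); exists (- r0) => r /= Kr.
  have := KD _ _ _ _ Kr0 Kr; rewrite addNr => /K0; lra.
pose q v := inf [set r | K v r].
have qle v r : K v r -> q v <= r.
  by move=> Kr; apply: ge_inf => //; exact: (Kinf v).2.
have [|p lp pq] := @hahn_banach q; last first.
  by exists p => // v r /qle; exact: le_trans.
apply: sublinear_le => [v w|t v t0].
  apply/ler_addgt0Pr => e e0.
  have e20 : 0 < e / 2 by lra.
  have [r1 /= K1 h1] := inf_adherent e20 (Kinf v).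
  have [r2 /= K2 h2] := inf_adherent e20 (Kinf w).
  have := qle _ _ (KD _ _ _ _ K1 K2); rewrite /q in h1 h2 *; lra.
rewrite -ler_pdivrMl//; apply: lb_le_inf; first exact: (Kinf _).1.
by move=> r /= Kr; rewrite ler_pdivrMl//; apply: qle; exact: KZ.
Qed.

End HahnBanach.

(** * Affine minorants of the maximum of two convex functions *)

Section Splitting.
Context {R : realType} (X : normedModType R).
Implicit Types (P Q : X -> R -> Prop) (x : X) (l y u : dual X).

(* Convex functions are represented by their epigraphs, as relations between
   points and reals; this allows the value [-oo]. *)
Record epigraph P : Prop := Epigraph {
  epigraph_up : forall x a b, P x a -> a <= b -> P x b;
  epigraph_convex : forall x x' a a' t, 0 <= t <= 1 -> P x a -> P x' a' ->
    P (t *: x + (1 - t) *: x') (t * a + (1 - t) * a') }.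

(** Convexity in homogeneous form, for weights that need not sum to 1: the cone over an epigraph is
    closed under addition. *)
Lemma epigraph_combine P x x' a a' s s' : epigraph P -> 0 < s -> 0 < s' ->
  P x a -> P x' a' ->
  exists x'' a'', [/\ P x'' a'', (s + s') *: x'' = s *: x + s' *: x' &
    (s + s') * a'' = s * a + s' * a'].
Proof.
move=> eP s0 s'0 Px Px'; have ss0 : s + s' != 0 by rewrite gt_eqF// addr_gt0.
have E : 1 - s / (s + s') = s' / (s + s') by field.
have t01 : 0 <= s / (s + s') <= 1.
  rewrite ler_pdivrMr ?addr_gt0// mul1r lerDl (ltW s'0) andbT.
  by rewrite divr_ge0// ltW// addr_gt0.
exists (s / (s + s') *: x + (1 - s / (s + s')) *: x').
exists (s / (s + s') * a + (1 - s / (s + s')) * a'); split.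
- exact: epigraph_convex.
- by rewrite E scalerDr !scalerA !(mulrC (s + s')) !divfK.
- by rewrite E; field.
Qed.

Lemma dualDE y u x : (y + u) x = (y x : R) + (u x : R).
Proof. by []. Qed.

Lemma dualNE u x : (- u) x = - (u x : R).
Proof. by []. Qed.

Lemma dual0 u : (u 0 : R) = 0.
Proof. exact: linear0. Qed.

Lemma dualN u x : (u (- x) : R) = - (u x : R).
Proof. exact: linearN. Qed.

Lemma dualD u x x' : (u (x + x') : R) = (u x : R) + (u x' : R).
Proof. exact: linearD. Qed.

Lemma dualZ u (k : R) x : (u (k *: x) : R) = k * (u x : R).
Proof. exact: linearZ. Qed.

(** By the symmetry [x |-> - x], an upper bound on a ball is already a two-sided one. *)
Lemma dual_of_linear (p : X -> R^o) (r c : R) : linear p -> 0 < r ->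
  (forall x, `|x| <= r -> p x <= c) -> exists l, dual_fun l = p.
Proof.
move=> lp r0 pc.
pose pL := HB.pack_for {linear X -> R^o} p (GRing.isLinear.Build R X R^o *:%R p lp).
suff cp : continuous pL.
  have ip : p \in @dual_pred R X by apply/asboolP; split.
  by exists (Dual ip).
apply: bounded_linear_continuous; apply/ex_bound; exists c.
apply/nbhs_normP; exists r => //= x /=; rewrite sub0r normrN => /ltW xr.
rewrite ler_norml pc// andbT lerNl.
have -> : - p x = pL (- x) by rewrite linearN.
by apply: pc; rewrite normrN.
Qed.

(* Exact conjugate of a maximum (or of a weighted sum): with [m = 1] and [P],
   [Q] the epigraphs of [g] and [h], an affine minorant [l - b] of
   [max g h] splits into minorants of [lam g] and of [(1 - lam) h], where
   [0 h] is the indicator function of the domain of [h]. *)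
Lemma minorant_split P Q l (b m r c : R) (x1 : X) (a1 : R) :
  epigraph P -> epigraph Q -> P x1 a1 -> 0 < r ->
  (forall x, `|x - x1| <= r -> Q x c) -> 0 <= m ->
  (forall x a, P x a -> Q x a -> (l x : R) - b <= m * a) ->
  exists y u (s t lam : R), [/\ 0 <= lam <= m, y + u = l, s + t = b,
    forall x a, P x a -> (y x : R) - s <= lam * a &
    forall x a, Q x a -> (u x : R) - t <= (m - lam) * a].
Proof.
move=> eP eQ Px1 r0 Qball m0 lPQ.
pose V : lmodType R := (X * R^o)%type.
(* The cone over the differences of a point of [P] and a point of [Q]. Over the origin the two
   points coincide, and [0 <= rho] is then the hypothesis on [l]. *)
pose K (v : V) (rho : R) := exists (s : R) x a x' a',
  [/\ 0 < s, P x a, Q x' a', v = (s *: x - s *: x', s * a - s * a') :> V &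
      rho = s * (m * a' - l x + b)].
have [| | | |p lp pK] := @hahn_banach_cone R V K.
- move=> v w rv rw [s [x [a [x' [a' [s0 Px Qx' -> ->]]]]]].
  move=> [t [y [d [y' [d' [t0 Py Qy' -> ->]]]]]].
  have [x2 [a2 [Px2 Ex2 Ea2]]] := epigraph_combine eP s0 t0 Px Py.
  have [x2' [a2' [Qx2 Ex2' Ea2']]] := epigraph_combine eQ s0 t0 Qx' Qy'.
  exists (s + t), x2, a2, x2', a2'; split => //; first exact: addr_gt0.
    rewrite Ex2 Ex2' Ea2 Ea2'; congr (_, _) => /=; last by ring.
    by rewrite opprD addrACA.
  have El : (s + t) * l x2 = s * l x + t * l y.
    by have := congr1 l Ex2; rewrite linearD !linearZ.
  transitivity (m * ((s + t) * a2') - (s + t) * l x2 + (s + t) * b); last by ring.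
  by rewrite Ea2' El; ring.
- move=> t v rv t0 [s [x [a [x' [a' [s0 Px Qx' -> ->]]]]]].
  exists (t * s), x, a, x', a'; split => //; first exact: mulr_gt0.
    by congr (_, _) => /=; rewrite ?scalerBr ?scalerA// /GRing.scale/=; ring.
  by rewrite mulrA.
- move=> [w g].
  (* This scale brings [w / s] into the ball of radius [r], so that [x1 - w / s] is available for
     [Q]; [a] is large enough for both epigraphs. *)
  pose s := (`|w| + 1) / r; have s0 : 0 < s by rewrite divr_gt0// ltr_wpDl.
  pose a := Num.max a1 (c + g / s).
  exists (s * (m * (a - g / s) - l x1 + b)), s, x1, a, (x1 - s^-1 *: w), (a - g / s).
  split => //.
  + by apply: (epigraph_up eP) Px1 _; rewrite le_max lexx.
  + apply: (epigraph_up eQ) (Qball _ _) _.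
      rewrite addrC addKr normrN normrZ gtr0_norm ?invr_gt0// ler_pdivrMl//.
      by rewrite divfK ?gt_eqF// lerDl.
    by rewrite lerBrDr le_max lexx orbT.
  + congr (_, _); first by rewrite scalerBr scalerA divff ?gt_eqF// scale1r subKr.
    by field; rewrite gt_eqF.
- move=> rv [s [x [a [x' [a' [s0 Px Qx' /esym[/eqP + /eqP +] ->]]]]]].
  rewrite -scalerBr -mulrBr scaler_eq0 mulf_eq0 (gt_eqF s0)/= !subr_eq0.
  move=> /eqP xx' /eqP aa'; subst x' a'; apply: mulr_ge0; first exact: ltW.
  by have := lPQ _ _ Px Qx'; lra.
pose p1 (x : X) : R := p (x, 0); pose k := p (0, 1).
have pE (x : X) (g : R) : p (x, g) = p1 x + g * k.
  have -> : (x, g) = g *: ((0, 1) : V) + ((x, 0) : V) :> V.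
    congr (_, _); first by rewrite /= scaler0 add0r.
    by rewrite /= addr0 /GRing.scale/= mulr1.
  by rewrite lp addrC.
have pPQ x a x' a' : P x a -> Q x' a' ->
    p1 (x - x') + (a - a') * k <= m * a' - l x + b.
  move=> Px Qx'; rewrite -pE; apply: pK; exists 1, x, a, x', a'.
  by split => //; rewrite ?scale1r ?mul1r.
have lp1 : linear (p1 : X -> R^o).
  move=> t x y; rewrite /p1 -(lp t (x, 0) (y, 0)); congr p.
  by congr (_, _); rewrite /= scaler0 addr0.
have Qx1 : Q x1 c by apply: Qball; rewrite subrr normr0 ltW.
have [q qE] : exists q : dual X, dual_fun q = p1.
  apply: (dual_of_linear lp1 r0 (c := m * c - l x1 + b - (a1 - c) * k)) => w wr.
  have /pPQ/(_ (Qball (x1 - w) _)) : P x1 a1 by [].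
  by rewrite subKr addrC addKr normrN => /(_ wr); lra.
rewrite -qE in pPQ.
have pPQ' x a x' a' : P x a -> Q x' a' ->
    q x - q x' + (a - a') * k <= m * a' - l x + b.
  by move=> Px Qx'; rewrite -linearB; exact: pPQ.
(* The multiplier is [lam = - k]: letting [a] grow in [P] forces [k <= 0], and letting [a'] grow in
   [Q] forces [- k <= m]. *)
have k0 : k <= 0.
  rewrite leNgt; apply/negP => k0.
  pose d := m * c - l x1 + b - (a1 - c) * k.
  have /pPQ'/(_ Qx1) : P x1 (a1 + (`|d| + 1) / k).
    apply: (epigraph_up eP) Px1 _; rewrite lerDl; apply: divr_ge0; [exact: addr_ge0|exact: ltW].
  rewrite subrr add0r -addrA (addrC _ (- c)) addrA mulrDl divfK ?gt_eqF//.
  by have := ler_norm d; rewrite /d; lra.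
have km : - k <= m.
  rewrite leNgt; apply/negP => km.
  have mk0 : 0 < - k - m by lra.
  pose d := m * c - l x1 + b - (a1 - c) * k.
  have /(pPQ' _ _ _ _ Px1) : Q x1 (c + (`|d| + 1) / (- k - m)).
    apply: (epigraph_up eQ) Qx1 _; rewrite lerDl; apply: divr_ge0; [exact: addr_ge0|exact: ltW].
  rewrite subrr add0r; set e := _ / _.
  have Ee : e * (- k - m) = `|d| + 1 by rewrite /e divfK ?gt_eqF.
  by have := ler_norm d; rewrite /d in Ee *; nra.
(* In [pPQ'] the variables of [P] and [Q] separate; any number between the two sides is an
   intercept, and [sup S] is one. *)
pose S : set R := [set z | exists x a, P x a /\ z = (q x : R) + (l x : R) + a * k].
have Sub x' a' : Q x' a' -> ubound S ((m + k) * a' + (q x' : R) + b).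
  by move=> Qx' _ [x [a [Px ->]]]; have := pPQ' _ _ _ _ Px Qx'; lra.
have Ssup : has_sup S.
  split; last by exists ((m + k) * c + (q x1 : R) + b); exact: Sub.
  by exists ((q x1 : R) + (l x1 : R) + a1 * k), x1, a1.
exists (q + l), (- q), (sup S), (b - sup S), (- k); split.
- by rewrite km oppr_ge0 k0.
- by rewrite addrAC subrr add0r.
- by rewrite addrC subrK.
- move=> x a Px; have : (q x : R) + (l x : R) + a * k <= sup S.
    by apply: ub_le_sup; [exact: Ssup.2|exists x, a].
  rewrite dualDE; lra.
- move=> x' a' /Sub/(ge_sup Ssup.1).
  rewrite dualNE; lra.
Qed.

End Splitting.

(** * Norm convergence of a sequence of functionals *)

Section DualLimits.
Context {R : realType} (X : normedModType R).

(* [n |-> u n w - tau n] is nondecreasing on the ball, which gives the pointwise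
   limits and a uniform rate of convergence. *)
Lemma dual_sequence_cvg (u : nat -> dual X) (tau : nat -> R) (r : R) : 0 < r ->
  (forall n w, `|w| <= r -> (u n w : R) - u n.+1 w <= tau n - tau n.+1) ->
  (forall n w, `|w| <= r -> u n w <= tau n) ->
  exists v : dual X, [/\ cvgn tau, u n @[n --> \oo] --> v &
    forall w, (u n w : R) @[n --> \oo] --> (v w : R)].
Proof.
move=> r0 du utau.
have tau_noninc : nonincreasing_seq tau.
  apply/nonincreasing_seqP => n; have := du n 0.
  by rewrite normr0 !dual0 subrr subr_ge0; apply; exact: ltW.
have tau_cvg : cvgn tau.
  apply: nonincreasing_is_cvgn => //; exists 0 => _ [n _ <-].
  by have := utau n 0; rewrite normr0 dual0; apply; exact: ltW.
pose d w n : R := (u n w : R) - tau n.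
have d_nondec w : `|w| <= r -> nondecreasing_seq (d w).
  move=> wr; apply/nondecreasing_seqP => n; rewrite /d.
  by have := du n _ wr; lra.
have d_cvg w : `|w| <= r -> cvgn (d w).
  move=> wr; apply: nondecreasing_is_cvgn; first exact: d_nondec.
  by exists 0 => _ [n _ <-]; rewrite /d subr_le0; exact: utau.
have u_cvg_ball w : `|w| <= r -> cvgn (fun n => u n w : R).
  move=> wr; rewrite (_ : (fun n => u n w : R) = d w \+ tau).
    by apply: is_cvgD => //; exact: d_cvg.
  by apply/funext => n /=; rewrite /d subrK.
have u_cvg w : cvgn (fun n => u n w : R).
  pose k := (`|w| + 1) / r; have k0 : 0 < k by rewrite divr_gt0// ltr_wpDl.
  rewrite (_ : (fun n => _) = fun n => k * (u n (k^-1 *: w) : R)).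
    apply: is_cvgMr; apply: u_cvg_ball; rewrite normrZ gtr0_norm ?invr_gt0//.
    by rewrite ler_pdivrMl// divfK ?gt_eqF// lerDl.
  apply/funext => n.
  by rewrite -dualZ scalerA divff ?gt_eqF// scale1r.
pose p w : R := limn (fun n => u n w : R).
have u_p w : (u n w : R) @[n --> \oo] --> p w by exact: u_cvg.
have lp : linear (p : X -> R^o).
  move=> k w w'; apply: cvg_lim => //.
  rewrite (_ : (fun n => _) = fun n => k * (u n w : R) + (u n w' : R)).
    by apply: cvgD => //; apply: cvgMr; exact: u_p.
  by apply/funext => n; rewrite linearP.
have [v vE] : exists v : dual X, dual_fun v = p.
  apply: (dual_of_linear lp r0 (c := tau 0)) => w wr.
  apply: limr_le; first exact: u_cvg.
  by apply: nearW => n; rewrite (le_trans (utau n _ wr))//; exact: tau_noninc.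
exists v; split => //; last by rewrite vE.
have rate n w : `|w| <= r -> (u n w : R) - v w <= tau n - limn tau.
  move=> wr; have := nondecreasing_cvgn_le (d_nondec _ wr) (d_cvg _ wr) n.
  have -> : limn (d w) = p w - limn tau.
    by apply: cvg_lim => //; apply: cvgB => //; exact: u_p.
  by rewrite /d vE; lra.
(* The one-sided rate at [r *: w] and at its opposite gives a bound in norm. *)
have norm_rate n : `|v - u n| <= (tau n - limn tau) / r.
  apply: dual_norm_le => w w1.
  have rw : `|r *: w| <= r by rewrite normrZ gtr0_norm// ger_pMr.
  have rwN : `|- (r *: w)| <= r by rewrite normrN.
  have := rate n _ rw; have := rate n _ rwN; rewrite !dualN !dualZ => h1 h2.
  rewrite dualDE dualNE ler_norml ler_pdivlMr// -mulNr ler_pdivrMr//.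
  by apply/andP; split; lra.
apply/cvgrPdist_le => e e0.
have er0 : 0 < e * r by exact: mulr_gt0.
have /cvgrPdist_le/(_ _ er0) := tau_cvg.
apply: filterS => n; rewrite distrC => h.
rewrite (le_trans (norm_rate n))// ler_pdivrMr//.
exact: le_trans (ler_norm _) h.
Qed.

End DualLimits.

(** * Splitting an affine minorant of a countable supremum *)

Section CountableSplitting.
Context {R : realType} (X : normedModType R).

(* By separation, [z] lies in the weak-star closed convex hull of [D]. *)
Definition bipolar (D : set X) (z : dual (dual X)) : Prop :=
  forall (u : dual X) (c : R), (forall x, D x -> u x <= c) -> z u <= c.

(* With [P] the epigraph of [h], the case [lam > 0] says [h** z <= 0] and the case
   [lam = 0] says that [z] is in the weak-star closure of the domain of [h]. *)
Definition nonpos_at (P : X -> R -> Prop) (z : dual (dual X)) : Prop :=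
  forall (y : dual X) (s lam : R), 0 <= lam ->
    (forall x a, P x a -> (y x : R) - s <= lam * a) -> z y <= s.

Variables (P : nat -> X -> R -> Prop) (D : set X) (z : dual (dual X)).
Variables (x1 : X) (r : R).
Hypothesis P_epi : forall k, epigraph (P k).
Hypothesis D_convex : epigraph (fun x _ => D x).
Hypothesis r_gt0 : 0 < r.
Hypothesis ball_D : forall x, `|x - x1| <= r -> D x.
Hypothesis ball_P : forall x k, `|x - x1| <= r -> P k x 0.

Definition tail_sup n x (b : R) : Prop := D x /\ forall k, (n <= k)%N -> P k x b.

(** For epigraphs of functions this set lies between the strict epigraph of their limsup and its
    epigraph, which is precise enough for affine minorants. *)
Definition limsup_epi x (a : R) : Prop :=
  exists n, forall k, (n <= k)%N -> P k x a.

Lemma tail_sup_epi n : epigraph (tail_sup n).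
Proof.
split=> [x a b [Dx Px] ab|x x' a a' t t01 [Dx Px] [Dx' Px']].
  by split=> // k nk; exact: epigraph_up (Px _ nk) ab.
split=> [|k nk]; first exact: (epigraph_convex D_convex (a := 0) (a' := 0) t01 Dx Dx').
by apply: epigraph_convex; [exact: P_epi|exact: t01|exact: Px|exact: Px'].
Qed.

Lemma limsup_epi_epi : epigraph limsup_epi.
Proof.
split=> [x a b [n Px] ab|x x' a a' t t01 [n Px] [n' Px']].
  by exists n => k nk; exact: epigraph_up (Px _ nk) ab.
exists (maxn n n') => k; rewrite geq_max => /andP[nk n'k].
by apply: epigraph_convex; [exact: P_epi|exact: t01|exact: Px|exact: Px'].
Qed.

Hypothesis zP : forall k, nonpos_at (P k) z.
Hypothesis zD : bipolar D z.

Let tail_minorant n (u : dual X) (t m : R) :=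
  0 <= m /\ forall x b, tail_sup n x b -> (u x : R) - t <= m * b.

Let ball_tail n x : `|x - x1| <= r -> tail_sup n x 0.
Proof. by move=> xr; split=> [|k _]; [exact: ball_D|exact: ball_P]. Qed.

(** The piece [y - s] split off for [P n] is nonpositive at [z] by [zP] and on the ball by [ball_P];
    removing it therefore can only increase the value at these points. *)
Lemma tail_minorant_step n (u : dual X) (t m : R) : tail_minorant n u t m ->
  exists u' t' m', [/\ tail_minorant n.+1 u' t' m', m' <= m,
    (z u : R) - t <= (z u' : R) - t' &
    forall x, `|x - x1| <= r -> (u x : R) - u' x <= t - t'].
Proof.
move=> [m0 um].
have x11 : `|x1 - x1| <= r by rewrite subrr normr0 ltW.
have [|y [u' [s [t' [lam [/andP[lam0 lamm] yu st yP uQ]]]]]] :=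
    minorant_split (P_epi n) (tail_sup_epi n.+1) (ball_P n x11) r_gt0
      (@ball_tail n.+1) m0 (l := u) (b := t).
  move=> x a Pn [Dx Pk]; apply: um; split=> // k.
  by rewrite leq_eqVlt => /predU1P[<-//|]; exact: Pk.
exists u', t', (m - lam); split.
- by split=> //; rewrite subr_ge0.
- by rewrite gerBl.
- rewrite -yu -st linearD /=; have := zP lam0 yP; lra.
- move=> x xr; rewrite -yu -st dualDE.
  by have := yP _ _ (ball_P n xr); lra.
Qed.

Lemma tail_minorant_sequence (u0 : dual X) (t0 m0 : R) :
  tail_minorant 0 u0 t0 m0 ->
  exists (u : nat -> dual X) (t m : nat -> R), [/\ u 0 = u0, t 0 = t0 &
    forall n, [/\ tail_minorant n (u n) (t n) (m n), m n.+1 <= m n,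
      (z (u n) : R) - t n <= (z (u n.+1) : R) - t n.+1 &
      forall x, `|x - x1| <= r -> (u n x : R) - u n.+1 x <= t n - t n.+1]].
Proof.
move=> m00.
have /choice[g gP] (q : nat * (dual X * R * R)) : exists q' : dual X * R * R,
    tail_minorant q.1 q.2.1.1 q.2.1.2 q.2.2 ->
    [/\ tail_minorant q.1.+1 q'.1.1 q'.1.2 q'.2, q'.2 <= q.2.2,
      (z q.2.1.1 : R) - q.2.1.2 <= (z q'.1.1 : R) - q'.1.2 &
      forall x, `|x - x1| <= r -> (q.2.1.1 x : R) - q'.1.1 x <= q.2.1.2 - q'.1.2].
  case: q => n [[u t] m] /=.
  have [/tail_minorant_step[u' [t' [m' H]]]|nH] :=
    pselect (tail_minorant n u t m); last by exists (0, 0, 0).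
  by exists (u', t', m').
pose fix st n := if n is k.+1 then g (k, st k) else (u0, t0, m0).
have stP n : tail_minorant n (st n).1.1 (st n).1.2 (st n).2.
  by elim: n => // n /(gP (n, st n))[].
exists (fun n => (st n).1.1), (fun n => (st n).1.2), (fun n => (st n).2).
split=> // n; have [? ? ? ?] := gP (n, st n) (stP n).
by split=> //; exact: stP.
Qed.

(* Here [m = lim m n] is the mass escaping to infinity: it multiplies the limsup
   and, when it vanishes, the remaining part of [u] is controlled on [D] only. *)
Lemma countable_splitting (u0 : dual X) (t0 m0 : R) : 0 <= m0 ->
  (forall x b, D x -> (forall k, P k x b) -> (u0 x : R) - t0 <= m0 * b) ->
  nonpos_at limsup_epi z -> z u0 <= t0.
Proof.
move=> m00 u0m zinf.
have [|u [t [m [uu0 tt0 utm]]]] := @tail_minorant_sequence u0 t0 m0.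
  by split=> // x b [Dx Px]; apply: u0m => // k; exact: Px.
(* Recentring at [x1] turns the estimates on the ball into the hypotheses of [dual_sequence_cvg]. *)
pose tau n : R := t n - (u n x1 : R).
have shift w : `|w| <= r -> `|x1 + w - x1| <= r by rewrite addrC addKr.
have [n w wr|n w wr|v [tau_cvg uv uvw]] := @dual_sequence_cvg R X u tau r r_gt0.
- have [_ _ _ /(_ _ (shift _ wr))] := utm n.
  by rewrite !dualD /tau; lra.
- have [[_ uQ] _ _ _] := utm n; have := uQ _ _ (ball_tail n (shift _ wr)).
  by rewrite dualD mulr0 /tau; lra.
pose s : R := limn tau + (v x1 : R).
have ts : t n @[n --> \oo] --> s.
  rewrite (_ : t = fun n => tau n + (u n x1 : R)).
    by apply: cvgD => //; exact: uvw.
  by apply/funext => n; rewrite /tau subrK.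
have m_noninc : nonincreasing_seq m.
  by apply/nonincreasing_seqP => n; have [] := utm n.
have m_ge0 n : 0 <= m n by have [[]] := utm n.
have m_cvg : cvgn m.
  by apply: nonincreasing_is_cvgn => //; exists 0 => _ [n _ <-].
(* Norm convergence of [u] matters here, since [z] is only norm continuous on [dual X]. *)
have zuv : (z (u n) : R) - t n @[n --> \oo] --> (z v : R) - s.
  apply: cvgB => //.
  by apply: (@cvg_comp _ _ _ u (z : dual X -> R^o)); [exact: uv|exact: dual_continuous].
have zu_nondec : nondecreasing_seq (fun n => (z (u n) : R) - t n).
  by apply/nondecreasing_seqP => n; have [] := utm n.
have zu0 : (z u0 : R) - t0 <= (z v : R) - s.
  rewrite -uu0 -tt0 -(cvg_lim _ zuv)//.
  by apply: (nondecreasing_cvgn_le zu_nondec); apply/cvg_ex; eexists; exact: zuv.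
suff : z v <= s by lra.
(* The second relation is the epigraph of the function equal to [-oo] on [D] and [+oo] elsewhere;
   its maximum with the limsup is the limsup restricted to [D]. *)
have [||x a [n Pn] Dx|y [w [b [c [lam [/andP[lam0 lamm] ywv bcs yinf wD]]]]]] :=
    @minorant_split R X limsup_epi (fun x _ => D x) v s (limn m) r 0 x1 0
      limsup_epi_epi D_convex _ r_gt0 ball_D.
- by exists 0 => k _; apply: ball_P; rewrite subrr normr0 ltW.
- by apply: limr_ge => //; exact: nearW.
- have ul : (u n x : R) - t n @[n --> \oo] --> (v x : R) - s.
    by apply: cvgB => //; exact: uvw.
  have ml : m n * a @[n --> \oo] --> limn m * a by apply: cvgMl.
  rewrite -(cvg_lim _ ul)// -(cvg_lim _ ml)//; apply: ler_lim.
  + by apply/cvg_ex; eexists; exact: ul.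
  + by apply/cvg_ex; eexists; exact: ml.
  + exists n => // k nk; have [[_ ukm] _ _ _] := utm k.
    by apply: ukm; split=> // j kj; apply: Pn; exact: leq_trans kj.
rewrite -ywv -bcs dualD lerD//; first exact: zinf lam0 yinf.
apply: zD => x Dx; have := wD _ 0 Dx; rewrite mulr0; lra.
Qed.

End CountableSplitting.

(** * Biconjugates, domains and weak-star closures *)

Section Biconjugates.
Context {R : realType} (X : normedModType R).
Implicit Types (h : X -> \bar R) (y u : dual X) (z : dual (dual X)).
Local Open Scope ereal_scope.

Lemma epigraph_econvex h : econvex h -> epigraph (fun x a => h x <= a%:E).
Proof.
move=> ch; split=> [x a b ha ab|x x' a a' t t01 ha ha'].
  by rewrite (le_trans ha)// lee_fin.
rewrite (le_trans (ch _ _ _ t01))// [leRHS]EFinD !EFinM; case/andP: t01 => t0 t1.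
by rewrite leeD// lee_wpmul2l// lee_fin// subr_ge0.
Qed.

(** The strict inequality matches what [flimsup_lt] provides. The hypothesis also excludes the value
    [-oo], where [a] would be arbitrarily negative. *)
Lemma conjugate_le h y (c : R) :
  (forall x (a : R), h x < a%:E -> ((y x : R) - c <= a)%R) -> conjugate h y <= c%:E.
Proof.
move=> yc; apply: ge_ereal_sup => _ [x _ <-].
case: (h x) (yc x) => [b yxb|_|yxN].
- rewrite -EFinB lee_fin lerBlDr -lerBlDl; apply/ler_addgt0Pr => e e0.
  by apply: yxb; rewrite lte_fin ltrDl.
- by rewrite leNye.
- by exfalso; have := yxN ((y x : R) - c - 1)%R (ltNyr _); lra.
Qed.

Lemma minorant_biconjugate h z y (c : R) :
  (forall x (a : R), h x < a%:E -> ((y x : R) - c <= a)%R) ->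
  ((z y : R) - c)%:E <= biconjugate h z.
Proof.
move=> /conjugate_le yc; apply: le_ereal_sup_tmp.
by exists ((z y : R)%:E - conjugate h y); [exists y|rewrite EFinB leeB].
Qed.

(** For [lam = 0], [y - s] is nonpositive on the domain of [h], hence on [D], and [bipolar] applies.
    For [lam > 0], division by [lam] gives an affine minorant of [h]. *)
Lemma nonpos_at_biconjugate h (P : X -> R -> Prop) (D : set X) z :
  (forall x (a : R), h x < a%:E -> P x a) -> D `<=` edom h ->
  bipolar D z -> biconjugate h z <= 0 -> nonpos_at P z.
Proof.
move=> hP Dh zD hz y s lam; rewrite le_eqVlt => /predU1P[<-|lam0] Py.
  have {}Py x a : P x a -> ((y x : R) - s <= 0)%R by move/Py; rewrite mul0r.
  apply: zD => x /Dh; rewrite /edom/=; case hx : (h x) => [b| |]// _.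
    have /hP/Py : h x < (b + 1)%:E by rewrite hx lte_fin ltrDl.
    by rewrite subr_le0.
  have /hP/Py : h x < 0%:E by rewrite hx ltNyr.
  by rewrite subr_le0.
have := @minorant_biconjugate h z (lam^-1 *: y) (s / lam)%R.
move=> /(_ _)/le_trans/(_ hz); rewrite lee_fin dualZ [(lam^-1 * _)%R]mulrC -mulrBl.
rewrite pmulr_lle0 ?invr_gt0// subr_le0; apply=> x a /hP/Py.
rewrite [((lam^-1 *: y) x)](_ : _ = lam^-1 * (y x : R))%R//.
by rewrite [(lam^-1 * _)%R]mulrC -mulrBl ler_pdivrMr// mulrC.
Qed.

Lemma bipolar_setT z : bipolar setT z.
Proof.
move=> u c uc.
have u_le0 x : (u x <= 0)%R.
  rewrite leNgt; apply/negP => ux0.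
  have := uc ((`|c| + 1) / (u x : R) *: x)%R I.
  by rewrite dualZ divfK ?gt_eqF//; have := ler_norm c; lra.
have -> : u = 0%R.
  apply/val_inj/funext => x /=; apply/eqP; rewrite eq_le u_le0/=.
  by have := u_le0 (- x)%R; rewrite dualN oppr_le0.
by rewrite dual0 -(dual0 u); exact: uc.
Qed.

(** If [u <= c] on the domain, adding [t (u - c)] with [t >= 0] to an affine minorant gives another
    one. If [z u > c], large [t] would make the biconjugate infinite at [z]. *)
Lemma bipolar_edom_biconjugate h z y0 (c0 : R) :
  (forall x (a : R), h x < a%:E -> ((y0 x : R) - c0 <= a)%R) ->
  edom (biconjugate h) z -> bipolar (edom h) z.
Proof.
rewrite /edom/= => hy0 hz u c uc.
have mino (t : R) : (0 <= t)%R ->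
    ((z y0 : R) - c0 + t * ((z u : R) - c))%:E <= biconjugate h z.
  move=> t0; rewrite (_ : _ - _ + _ = (z (y0 + t *: u)%R : R) - (c0 + t * c))%R;
    last by rewrite dualD dualZ; ring.
  apply: minorant_biconjugate => x a hxa; have := hy0 _ _ hxa.
  have := uc x (lt_trans hxa (ltry _)).
  rewrite [(y0 + t *: u)%R x](_ : _ = (y0 x : R) + t * (u x : R))%R//; nra.
rewrite leNgt; apply/negP => cu.
case: (biconjugate h z) hz mino => [b _ mino|//|_ mino].
- have e0 : (0 < (z u : R) - c)%R by rewrite subr_gt0.
  pose t := ((`|b - (z y0 : R) + c0| + 1) / ((z u : R) - c))%R.
  have t0 : (0 <= t)%R by apply: divr_ge0; [exact: addr_ge0|exact: ltW].
  have := mino t t0; rewrite lee_fin /t divfK ?gt_eqF//.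
  by have := ler_norm (b - (z y0 : R) + c0)%R; lra.
- by have := mino 0%R (lexx _).
Qed.

(** Evaluation at [u] is weak-star continuous, so each half-space [z u <= c] is weak-star closed. *)
Lemma bipolar_weak_star_closure (D : set X) (A : set (dual (dual X))) z :
  (forall z', A z' -> bipolar D z') -> weak_star_closure A z -> bipolar D z.
Proof.
move=> AD Az u c uc.
have cu : continuous (fun z' : weak_star (dual X) => (z' : dual (dual X)) u : R).
  move=> z'; apply: (@continuous_comp _ _ _
    (fun phi : weak_star (dual X) => (phi : {ptws dual X -> R^o})) (fun g => g u)).
    exact: initial_continuous.
  exact: proj_continuous.
pose S : set (weak_star (dual X)) := [set z' | (z' : dual (dual X)) u <= c]%R.
have cS : closed S by exact: (continuous_closedP _).1 cu _ (@closed_le _ (c : R)).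
have AS : (A : set (weak_star (dual X))) `<=` S by move=> z' Az'; exact: AD _ Az' _ _ uc.
by have := closure_subset AS Az; rewrite -((closure_id S).1 cS).
Qed.

End Biconjugates.

(** * The canonical embedding into the bidual *)

Section Embedding.
Context {R : realType} (X : normedModType R).
Local Open Scope ereal_scope.

Lemma dual_norm_bound (phi : dual X) (x : X) :
  (`|phi x| <= `|phi| * `|x|)%R.
Proof.
have [->|x0] := eqVneq x 0%R; first by rewrite dual0 !normr0 mulr0.
have x_gt0 : (0 < `|x|)%R by rewrite normr_gt0.
have := @dual_norm_ge R X phi (`|x|^-1 *: x)%R.
rewrite normrZ normfV normr_id mulVf ?gt_eqF// => /(_ (lexx _)).
by rewrite dualZ normrM normfV normr_id ler_pdivrMl// mulrC.
Qed.

Lemma bidual_eval (x : X) :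
  exists z : dual (dual X), forall phi : dual X, z phi = phi x.
Proof.
have le (phi : dual X) : (`|phi| <= 1 -> phi x <= `|x|)%R.
  move=> phi1; rewrite (le_trans (ler_norm _))// (le_trans (dual_norm_bound _ _))//.
  by rewrite ler_piMl.
have [|z zE] := dual_of_linear (p := fun phi : dual X => phi x) _ ltr01 le.
  by move=> a phi psi.
by exists z => phi; rewrite zE.
Qed.

Lemma biconjugate_eval_le (h : X -> \bar R) (x : X) (z : dual (dual X)) :
  (forall phi : dual X, z phi = phi x) -> biconjugate h z <= h x.
Proof.
move=> zx; apply: ge_ereal_sup => _ [phi _ <-]; rewrite zx.
have : (phi x : R)%:E - h x <= conjugate h phi.
  by apply: ereal_sup_ubound; exists x.
case: (h x) => [b| |].
- case: (conjugate h phi) => [c| |]//; last by rewrite leNye.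
  by rewrite -!EFinB !lee_fin; lra.
- by rewrite leey.
- by case: (conjugate h phi) => [c| |].
Qed.

End Embedding.

(** * The constraints, the easy inequality and the Slater ball *)

Section Constraints.
Context {R : realType} (X : normedModType R).
Variables (N : option nat) (f : nat -> X -> \bar R).
Local Open Scope ereal_scope.

Lemma fsup_le (x : X) (b : \bar R) :
  fsup N f x <= b <-> forall k, constraints N k -> f k x <= b.
Proof.
split=> [xb k Nk|fb]; last by apply: ge_ereal_sup => _ [k Nk <-]; exact: fb.
by apply: le_trans xb; apply: ereal_sup_ubound; exists k.
Qed.

(** An index outside [constraints N] gets the epigraph of the constant [-oo], so that finite and
    infinite families are both sequences over all of [nat]. *)
Definition constraint_epi k (x : X) (a : R) : Prop :=
  constraints N k -> f k x <= a%:E.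

Lemma edom_fsup (x : X) :
  edom (fsup N f) x <-> exists b : R, forall k, constraint_epi k x b.
Proof.
rewrite /edom/=; split=> [|[b xb]]; last first.
  by apply: le_lt_trans (ltry b); apply/fsup_le.
case xE : (fsup N f x) => [b| |]// _; [exists b|exists 0%R] => k Nk.
  by apply/fsup_le : k Nk; rewrite xE.
by apply/fsup_le : k Nk; rewrite xE leNye.
Qed.

Lemma flimsup_lt (x : X) (a : R) :
  flimsup N f x < a%:E -> limsup_epi constraint_epi x a.
Proof.
rewrite /flimsup /constraint_epi /constraints; case: N => [m _|].
  by exists m.+1 => k mk [_]; rewrite leqNgt mk.
move=> /ereal_inf_lt[_ [V [n _ nV] <-] xa].
exists n => k nk _; apply/ltW; apply: le_lt_trans xa.
by apply: ereal_sup_ubound; exists k => //; exact: nV.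
Qed.

Lemma flimsup_le (x : X) (b : \bar R) :
  (forall k, constraints N k -> f k x <= b) -> flimsup N f x <= b.
Proof.
rewrite /flimsup /constraints; case: N => [m _|fb]; first exact: leNye.
apply: ge_ereal_inf; exists (ereal_sup ((fun k => f k x) @` [set k | (0 < k)%N])).
  by exists [set k | (0 < k)%N] => //; exists 1%N.
by apply: ge_ereal_sup => _ [k k0 <-]; exact: fb.
Qed.

Lemma bidual_value_le_primal : bidual_value N f <= primal_value N f.
Proof.
apply: le_ereal_inf_tmp => _ [x fx <-].
have [z zx] := bidual_eval x.
apply: ge_ereal_inf; exists (biconjugate (f 0%N) z); last exact: biconjugate_eval_le.
exists z => //; split.
- by move=> k Nk; rewrite (le_trans (biconjugate_eval_le _ zx))//; exact: fx.
- by rewrite (le_trans (biconjugate_eval_le _ zx))// flimsup_le.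
- apply: subset_closure; apply: le_lt_trans (biconjugate_eval_le _ zx) _.
  by apply: (@le_lt_trans _ _ 0); [apply/fsup_le|rewrite ltry].
Qed.

Hypothesis f_convex : forall k, k = 0%N \/ constraints N k ->
  eproper (f k) /\ econvex (f k).

Lemma constraint_epi_epi k : epigraph (constraint_epi k).
Proof.
have [Nk|nNk] := pselect (constraints N k); last first.
  by split=> [x a b _ _ /nNk|x x' a a' t _ _ _ /nNk].
have [_ /epigraph_econvex ek] := f_convex (or_intror Nk).
split=> [x a b Px ab _|x x' a a' t t01 Px Px' _].
  exact: (epigraph_up ek) (Px Nk) ab.
exact: (epigraph_convex ek t01 (Px Nk) (Px' Nk)).
Qed.

Lemma edom_fsup_convex : epigraph (fun x (_ : R) => edom (fsup N f) x).
Proof.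
split=> // x x' _ _ t t01 /edom_fsup[b Px] /edom_fsup[b' Px'].
apply/edom_fsup; exists (t * b + (1 - t) * b')%R => k.
exact: (epigraph_convex (constraint_epi_epi k) t01 (Px k) (Px' k)).
Qed.

(* The Slater point need not be a continuity point, but a point of the open
   segment towards a continuity point is both. *)
Lemma slater_ball : slater N f ->
  (exists x : X, [/\ edom (f 0%N) x, edom (fsup N f) x &
     {for x, continuous (fsup N f)}]) ->
  exists (x1 : X) (r d : R), [/\ (0 < r)%R, (0 < d)%R, edom (f 0%N) x1 &
    forall x, (`|x - x1| <= r)%R -> forall k, constraint_epi k x (- d)].
Proof.
move=> [x0 f0x0 fx0] [x2 [f0x2 fx2 cx2]].
have [a [a0 Px0]] : exists a, (a < 0)%R /\ forall k, constraint_epi k x0 a.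
  have [b [b0 xb]] : exists b, (b < 0)%R /\ fsup N f x0 <= b%:E.
    move: fx0; case: (fsup N f x0) => [b b0|//|_]; first by exists b.
    by exists (-1)%R; rewrite leNye ltrN10.
  by exists b; split=> // k Nk; apply/fsup_le : k Nk.
have [c [rho [c0 rho0 Px2]]] : exists c rho : R, [/\ (0 <= c)%R, (0 < rho)%R &
    forall x, (`|x - x2| <= rho)%R -> forall k, constraint_epi k x c].
  have /edom_fsup[b Pb] := fx2.
  pose c := (`|b| + 1)%R.
  have x2c : fsup N f x2 < c%:E.
    apply: (@le_lt_trans _ _ b%:E); first by apply/fsup_le.
    by rewrite lte_fin (le_lt_trans (ler_norm _))// ltrDl.
  have /cx2 : nbhs (fsup N f x2) [set y | y < c%:E].
    by apply: open_nbhs_nbhs; split=> //; exact: open_ereal_lt_ereal.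
  move=> /nbhs_normP[rho /= rho0 H]; exists c, (rho / 2)%R; split.
  - exact: addr_ge0.
  - exact: divr_gt0.
  - move=> x xr k Nk.
    have /ltW/fsup_le/(_ k Nk)// : fsup N f x < c%:E.
    apply: H; rewrite /= distrC (le_lt_trans xr)//.
    by rewrite ltr_pdivrMr// ltr_pMr// ltr1n.
have ca : (0 < c - a)%R by lra.
(* Chosen so that [t c + (1 - t) a = a / 2 < 0]. The ball of radius [rho] about [x2] shrinks by the
   factor [t] towards [x0]. *)
pose t := ((- a / 2) / (c - a))%R.
have tca : (t * (c - a) = - a / 2)%R by rewrite /t divfK ?gt_eqF.
have t0 : (0 < t)%R by rewrite /t !divr_gt0// oppr_gt0.
have t01 : (0 <= t <= 1)%R.
  by rewrite ltW//= /t ler_pdivrMr// mul1r; lra.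
exists (t *: x2 + (1 - t) *: x0)%R, (t * rho)%R, (- a / 2)%R; split.
- exact: mulr_gt0.
- by rewrite divr_gt0// oppr_gt0.
- have [_ /epigraph_econvex e0] := f_convex (or_introl (erefl 0%N)).
  have real x : edom (f 0%N) x -> exists b : R, f 0%N x <= b%:E.
    rewrite /edom/=; case: (f 0%N x) => [b| |]// _; first by exists b.
    by exists 0%R; rewrite leNye.
  have [b0 h0] := real _ f0x0; have [b2 h2] := real _ f0x2.
  exact: le_lt_trans (epigraph_convex e0 t01 h2 h0) (ltry _).
- move=> x xr k.
  have -> : x = (t *: (x2 + t^-1 *: (x - (t *: x2 + (1 - t) *: x0))) + (1 - t) *: x0)%R.
    rewrite scalerDr scalerA divff ?gt_eqF// scale1r.
    by rewrite addrAC addrC subrK.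
  have -> : (- (- a / 2) = t * c + (1 - t) * a)%R by lra.
  apply: (epigraph_convex (constraint_epi_epi k) t01 _ (Px0 k)).
  apply: Px2; rewrite addrC addKr normrZ gtr0_norm ?invr_gt0//.
  by rewrite ler_pdivrMl.
Qed.

End Constraints.

(** * The lower bound at points feasible for the bidual problem *)

Section LowerBound.
Context {R : realType} (X : normedModType R).
Variables (N : option nat) (f : nat -> X -> \bar R).
Hypothesis f_convex : forall k, k = 0%N \/ constraints N k ->
  eproper (f k) /\ econvex (f k).
Variables (x1 : X) (r d : R).
Hypotheses (r_gt0 : 0 < r) (d_gt0 : 0 < d) (f0x1 : edom (f 0%N) x1).
Hypothesis ball_f :
  forall x, `|x - x1| <= r -> forall k, constraint_epi N f k x (- d).
Local Open Scope ereal_scope.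

Let x1_ball : (`|x1 - x1| <= r)%R.
Proof. by rewrite subrr normr0 ltW. Qed.

(** A subgradient of [f k0] at [x1] suffices. It comes from splitting the constant [f k0 x1], a
    minorant of [f k0] on the set of the single point [x1]. *)
Lemma fsup_minorant k0 : constraints N k0 -> exists (y : dual X) (c : R),
  forall x (a : R), fsup N f x < a%:E -> ((y x : R) - c <= a)%R.
Proof.
move=> Nk0; have [[fgt _] /epigraph_econvex eQ] := f_convex (or_intror Nk0).
pose P (x : X) (_ : R) := x = x1.
have eP : epigraph P.
  by split=> // x x' a a' t _ -> ->; rewrite /P -scalerDl subrKC scale1r.
have [b f1] : exists b : R, f k0 x1 = b%:E.
  have := fgt x1; have := ball_f x1_ball Nk0.
  by case: (f k0 x1) => [b| |]//; exists b.
have [||y [u [s [t [lam [/andP[lam0 _] _ _ yP uQ]]]]]] :=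
    @minorant_split R X P _ 0%R (- b)%R 1%R r (- d)%R x1 0%R eP eQ erefl r_gt0
      _ ler01.
- by move=> x xr; exact: ball_f.
- by move=> x a xE; rewrite xE f1 lee_fin mul1r sub0r opprK.
(* [P x1 a] holds for every real [a], so a positive [lam] would make [y x1 - s] arbitrarily
   negative. *)
have lam_eq0 : lam = 0%R.
  apply/eqP; rewrite eq_le lam0 andbT leNgt; apply/negP => lam_gt0.
  have := yP x1 ((- (`|(y x1 : R) - s| + 1)) / lam)%R erefl.
  rewrite mulrC divfK ?gt_eqF//.
  by have := ler_norm (- ((y x1 : R) - s)); rewrite normrN; lra.
exists u, t => x a xa; have := uQ x a; rewrite lam_eq0 subr0 mul1r; apply.
by apply: ltW; apply: le_lt_trans xa; apply: ereal_sup_ubound; exists k0.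
Qed.

(** With at least one constraint, [fsup] has an affine minorant. With none it is [-oo] everywhere,
    but then its domain is the whole space. *)
Lemma bipolar_bidual_feasible z :
  bidual_feasible N f z -> bipolar (edom (fsup N f)) z.
Proof.
move=> [_ _ zcl].
have [[k0 Nk0]|noN] := pselect (constraints N !=set0).
  have [y [c yc]] := fsup_minorant Nk0.
  apply: bipolar_weak_star_closure zcl => z'.
  exact: bipolar_edom_biconjugate yc.
suff -> : edom (fsup N f) = setT by exact: bipolar_setT.
apply/seteqP; split=> // x _; apply/edom_fsup; exists 0%R => k Nk.
by case: noN; exists k.
Qed.

Lemma nonpos_at_constraint k z :
  bidual_feasible N f z -> nonpos_at (constraint_epi N f k) z.
Proof.
move=> fz; have zD := bipolar_bidual_feasible fz; have [fzk _ _] := fz.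
have [Nk|nNk] := pselect (constraints N k).
  apply: (nonpos_at_biconjugate (h := f k) (D := edom (fsup N f))) => //.
  - by move=> x a xa _; exact: ltW.
  - move=> x /edom_fsup[b Px]; rewrite /edom/=.
    exact: le_lt_trans (Px k Nk) (ltry _).
  - exact: fzk.
move=> y s lam lam0 yP; apply: zD => x _.
have yPa a : ((y x : R) - s <= lam * a)%R by apply: yP.
by have := yPa 0%R; rewrite mulr0 subr_le0.
Qed.

Lemma nonpos_at_flimsup z :
  bidual_feasible N f z -> nonpos_at (limsup_epi (constraint_epi N f)) z.
Proof.
move=> fz; have zD := bipolar_bidual_feasible fz; have [_ fzinf _] := fz.
apply: (nonpos_at_biconjugate (h := flimsup N f) (D := edom (fsup N f))) => //.
  exact: flimsup_lt.
move=> x /edom_fsup[b Px]; rewrite /edom/=.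
exact: le_lt_trans (flimsup_le Px) (ltry _).
Qed.

Lemma primal_value_le_biconjugate z : primal_value N f < +oo ->
  bidual_feasible N f z -> primal_value N f <= biconjugate (f 0%N) z.
Proof.
have [_ /epigraph_econvex e0] := f_convex (or_introl (erefl 0%N)).
case vE : (primal_value N f) => [v| |]// _ fz; last exact: leNye.
pose D := edom (fsup N f).
pose Q := tail_sup (constraint_epi N f) D 0.
pose P (x : X) (a : R) := f 0%N x <= (a + v)%:E.
have eP : epigraph P.
  split=> [x a b Pxa ab|x x' a a' t t01 Pxa Px'a].
    by apply: (epigraph_up e0) Pxa _; rewrite lerD2r.
  have := epigraph_convex e0 t01 Pxa Px'a; rewrite /P.
  by congr (_ <= _%:E); ring.
have epi_k := constraint_epi_epi f_convex.
have eD := edom_fsup_convex f_convex.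
have eQ : epigraph Q by exact: tail_sup_epi.
have ball_D x : (`|x - x1| <= r)%R -> D x.
  by move=> /ball_f xd; apply/edom_fsup; exists (- d)%R.
have ball_Q x : (`|x - x1| <= r)%R -> Q x (- d)%R.
  by move=> xr; split=> [|k _]; [exact: ball_D|exact: ball_f].
have [a1 Px1] : exists a1, P x1 a1.
  move: f0x1; rewrite /edom /P/=; case: (f 0%N x1) => [b| |]// _.
    by exists (b - v)%R; rewrite subrK.
  by exists 0%R; rewrite leNye.
(* [0] minorizes the maximum of [f 0 - v] and [fsup]: a point where both are negative would be
   feasible with objective below [v]. *)
have [|y [u [s [t [lam [/andP[lam0 lam1] yu st yP uQ]]]]]] :=
    minorant_split eP eQ Px1 r_gt0 ball_Q ler01 (l := 0%R) (b := 0%R).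
  move=> x a Pxa [_ Qxa]; rewrite subr0 mul1r leNgt; apply/negP => a0.
  suff : v%:E <= (a + v)%:E by rewrite lee_fin lerDr leNgt a0.
  rewrite -vE (le_trans _ Pxa)//; apply: ereal_inf_lbound; exists x => // k Nk.
  by apply: le_trans (Qxa k _ Nk) _; rewrite ?lee_fin ?ltW.
have u_le : (z u <= t)%R.
  apply: (countable_splitting epi_k eD r_gt0 ball_D _ _ _ (u0 := u) (t0 := t)
    (m0 := 1 - lam)).
  - move=> x k xr; have d_le0 : (- d <= 0)%R by rewrite oppr_le0 ltW.
    exact: (epigraph_up (epi_k k) (@ball_f _ xr k) d_le0).
  - by move=> k; exact: nonpos_at_constraint.
  - exact: bipolar_bidual_feasible.
  - by rewrite subr_ge0.
  - by move=> x b Dx Px; apply: uQ; split.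
  - exact: nonpos_at_flimsup.
(* If [lam = 0], then at [x1] one has [y - s <= 0] and [u - t <= - d], although the two sum to
   [0]. *)
have lam_gt0 : (0 < lam)%R.
  rewrite lt_neqAle lam0 andbT; apply/eqP => lam_eq0.
  suff : (d <= 0)%R by rewrite leNgt d_gt0.
  have := uQ _ _ (ball_Q _ x1_ball); have := yP _ _ Px1.
  have /addr0_eq <- : ((y x1 : R) + (u x1 : R) = 0)%R by rewrite -dualDE yu.
  by rewrite -lam_eq0 -(addr0_eq st); lra.
have zyu : ((z y : R) + (z u : R) = 0)%R by rewrite -dualD yu dual0.
(* Dividing by [lam] makes [(y - s) / lam + v] an affine minorant of [f 0]; at [z] it is at least
   [v], because [z y - s = t - z u >= 0]. *)
apply: (@le_trans _ _ ((z (lam^-1 *: y)%R : R) - (s / lam - v))%:E).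
  rewrite lee_fin dualZ opprB addrCA lerDl [(_ / _)%R]mulrC -mulrBr.
  by rewrite pmulr_rge0 ?invr_gt0//; lra.
apply: minorant_biconjugate => x a xa.
rewrite [(lam^-1 *: y)%R x](_ : _ = lam^-1 * (y x : R))%R//.
have : P x (a - v)%R by rewrite /P subrK ltW.
by move=> /yP; rewrite -ler_pdivrMl// mulrBr [(_ * s)%R]mulrC; lra.
Qed.

End LowerBound.

Local Open Scope ereal_scope.

Theorem theorem6 (R : realType) (X : completeNormedModType R)
    (N : option nat) (f : nat -> X -> \bar R)
    (f_proper_convex : forall k : nat, k = 0%N \/ constraints N k ->
      eproper (f k) /\ econvex (f k))
    (value_lty : primal_value N f < +oo)
    (f_slater : slater N f)
    (f_continuous : exists x : X,
      [/\ edom (f 0%N) x, edom (fsup N f) x & {for x, continuous (fsup N f)}]) :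
  bidual_value N f = primal_value N f.
Proof.
have [x1 [r [d [r0 d0 f0x1 ball_f]]]] :=
  slater_ball f_proper_convex f_slater f_continuous.
apply/eqP; rewrite eq_le bidual_value_le_primal/=.
apply: le_ereal_inf_tmp => _ [z fz <-].
exact: (primal_value_le_biconjugate f_proper_convex r0 d0 f0x1 ball_f).
Qed.
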